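(* Let $(A,[\cdot,\cdot],\cdot)$ be an almost Poisson algebra and $(V,[\cdot,\cdot]_V,\cdot_V,\varrho,\mu)$ an $A$-module almost Poisson algebra. Let $\mathcal{R}:V\to A$ be a weighted relative Rota-Baxter operator of weight $\lambda\in\mathbb{K}$ with respect to $(V,[\cdot,\cdot]_V,\cdot_V,\varrho,\mu)$. Define operations on $V$ for $a,b\in V$ by $$[a,b]_\lambda=\lambda[a,b]_V,\quad a\diamond b=\varrho(\mathcal{R}(a))b,\quad a\cdot_\lambda b=\lambda\,a\cdot_Vb,\quad a\vartriangleright b=\mu(\mathcal{R}(a))b.$$ Then $(V,[\cdot,\cdot]_\lambda,\diamond,\cdot_\lambda,\vartriangleright)$ is an almost tridendriform Poisson algebra. Moreover, $\mathcal{R}$ is a homomorphism of almost Poisson algebras from the associated almost Poisson algebra $V^C$ of this almost tridendriform Poisson algebra to $(A,[\cdot,\cdot],\cdot)$.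
   Context: All vector spaces are finite dimensional over a field $\mathbb{K}$ of characteristic zero. An almost Poisson algebra $(A,[\cdot,\cdot],\cdot)$ is a vector space with a commutative associative bilinear product $\cdot$ and a skew-symmetric bilinear bracket satisfying $[x,y\cdot z]=[x,y]\cdot z+y\cdot[x,z]$ (no Jacobi identity is assumed). A homomorphism of almost Poisson algebras is a linear map preserving product and bracket. Let $(A,[\cdot,\cdot],\cdot)$ and $(V,[\cdot,\cdot]_V,\cdot_V)$ be almost Poisson algebras and $\varrho,\mu:A\to\mathrm{End}(V)$ linear maps. $(V,[\cdot,\cdot]_V,\cdot_V,\varrho,\mu)$ is an $A$-module almost Poisson algebra if for all $x,y\in A$, $a,b\in V$: $\mu(x\cdot y)=\mu(x)\mu(y)$; $\varrho(x\cdot y)=\mu(y)\varrho(x)+\mu(x)\varrho(y)$; $\mu([x,y])=\varrho(x)\mu(y)-\mu(y)\varrho(x)$; $\mu(x)(a\cdot_Vb)=(\mu(x)a)\cdot_Vb$; $\varrho(x)(a\cdot_Vb)=(\varrho(x)a)\cdot_Vb+a\cdot_V(\varrho(x)b)$; $[a,\mu(x)b]_V=-(\varrho(x)a)\cdot_Vb+\mu(x)[a,b]_V$. A linear map $\mathcal{R}:V\to A$ is a weighted relative Rota-Baxter operator of weight $\lambda\in\mathbb{K}$ with respect to $(V,[\cdot,\cdot]_V,\cdot_V,\varrho,\mu)$ if for all $a,b\in V$: $$\mathcal{R}(a)\cdot\mathcal{R}(b)=\mathcal{R}\big(\mu(\mathcal{R}(a))b+\mu(\mathcal{R}(b))a+\lambda\,a\cdot_Vb\big),$$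 $$[\mathcal{R}(a),\mathcal{R}(b)]=\mathcal{R}\big(\varrho(\mathcal{R}(a))b-\varrho(\mathcal{R}(b))a+\lambda[a,b]_V\big).$$ A commutative dendriform trialgebra is a vector space $B$ with bilinear operations $\cdot,\vartriangleright$ such that $(B,\cdot)$ is a commutative associative algebra and, with $x\circ y=x\vartriangleright y+y\vartriangleright x+x\cdot y$, one has $(x\circ y)\vartriangleright z=x\vartriangleright(y\vartriangleright z)$ and $(x\vartriangleright y)\cdot z=x\vartriangleright(y\cdot z)$. An almost tridendriform Poisson algebra $(B,[\cdot,\cdot],\diamond,\cdot,\vartriangleright)$ is a vector space with four bilinear operations such that $(B,[\cdot,\cdot],\cdot)$ is an almost Poisson algebra, $(B,\cdot,\vartriangleright)$ is a commutative dendriform trialgebra, and for all $x,y,z\in B$: $$x\diamond(y\cdot z)=(x\diamond y)\cdot z+y\cdot(x\diamond z),\qquad [x,z\vartriangleright y]=z\vartriangleright[x,y]-y\cdot(z\diamond x),$$ $$(y\circ z)\diamond x=z\vartriangleright(y\diamond x)+y\vartriangleright(z\diamond x),\qquad \{x,z\}\vartriangleright y=x\diamond(z\vartriangleright y)-z\vartriangleright(x\diamond y),$$ where $x\circ y=x\vartriangleright y+y\vartriangleright x+x\cdot y$ and $\{x,y\}=x\diamond y-y\diamond x+[x,y]$. Its associated almost Poisson algebra, denoted $B^C$, is $(B,\{\cdot,\cdot\},\circ)$. *)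

(* Defs.v *)
From mathcomp Require Import all_boot all_order all_algebra.

Set Implicit Arguments.
Unset Strict Implicit.
Unset Printing Implicit Defensive.

Import GRing.Theory.
Local Open Scope ring_scope.

(* An algebraic structure is a predicate on the operations of a vector space;
   bilinearity of the operations is among its axioms. *)

Section AlmostPoisson.

Variable K : fieldType.

Definition bilinear_op (U : vectType K) (f : U -> U -> U) : Prop :=
  bilinear_for *:%R *:%R f.

Record almost_poisson (A : vectType K) (br mul : A -> A -> A) : Prop := {
  ap_br_bilinear : bilinear_op br;
  ap_mul_bilinear : bilinear_op mul;
  ap_mulC : forall x y, mul x y = mul y x;
  ap_mulA : forall x y z, mul (mul x y) z = mul x (mul y z);
  ap_br_skew : forall x y, br x y = - br y x;
  ap_leibniz : forall x y z, br x (mul y z) = mul (br x y) z + mul y (br x z)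
}.

(* A homomorphism is between almost Poisson algebras, so that the source and the
   target satisfy the axioms is part of the notion. *)
Record almost_poisson_hom (A B : vectType K) (brA mulA : A -> A -> A)
    (brB mulB : B -> B -> B) (f : {linear A -> B}) : Prop := {
  aph_source : almost_poisson brA mulA;
  aph_target : almost_poisson brB mulB;
  aph_mul : forall x y, f (mulA x y) = mulB (f x) (f y);
  aph_br : forall x y, f (brA x y) = brB (f x) (f y)
}.

Record module_almost_poisson (A V : vectType K) (brA mulA : A -> A -> A)
    (brV mulV : V -> V -> V) (rho mu : {linear A -> 'End(V)}) : Prop := {
  mod_alg : almost_poisson brA mulA;
  mod_mod : almost_poisson brV mulV;
  mod_muM : forall x y, mu (mulA x y) = (mu x \o mu y)%VF;
  mod_rhoM : forall x y,
    rho (mulA x y) = (mu y \o rho x)%VF + (mu x \o rho y)%VF;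
  mod_mu_br : forall x y,
    mu (brA x y) = (rho x \o mu y)%VF - (mu y \o rho x)%VF;
  mod_mu_mul : forall x a b, mu x (mulV a b) = mulV (mu x a) b;
  mod_rho_mul : forall x a b,
    rho x (mulV a b) = mulV (rho x a) b + mulV a (rho x b);
  mod_br_mu : forall x a b,
    brV a (mu x b) = - mulV (rho x a) b + mu x (brV a b)
}.

Record rota_baxter (A V : vectType K) (brA mulA : A -> A -> A)
    (brV mulV : V -> V -> V) (rho mu : {linear A -> 'End(V)}) (lambda : K)
    (R : {linear V -> A}) : Prop := {
  rb_mul : forall a b,
    mulA (R a) (R b) = R (mu (R a) b + mu (R b) a + lambda *: mulV a b);
  rb_br : forall a b,
    brA (R a) (R b) = R (rho (R a) b - rho (R b) a + lambda *: brV a b)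
}.

Definition circ (B : vectType K) (mul tri : B -> B -> B) (x y : B) : B :=
  tri x y + tri y x + mul x y.

Definition curly (B : vectType K) (br dia : B -> B -> B) (x y : B) : B :=
  dia x y - dia y x + br x y.

Record comm_dendriform_trialgebra (B : vectType K) (mul tri : B -> B -> B) :
    Prop := {
  cdt_mul_bilinear : bilinear_op mul;
  cdt_tri_bilinear : bilinear_op tri;
  cdt_mulC : forall x y, mul x y = mul y x;
  cdt_mulA : forall x y z, mul (mul x y) z = mul x (mul y z);
  cdt_circ_tri : forall x y z, tri (circ mul tri x y) z = tri x (tri y z);
  cdt_tri_mul : forall x y z, mul (tri x y) z = tri x (mul y z)
}.

Record almost_tridendriform_poisson (B : vectType K)
    (br dia mul tri : B -> B -> B) : Prop := {
  atp_poisson : almost_poisson br mul;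
  atp_trialgebra : comm_dendriform_trialgebra mul tri;
  atp_dia_bilinear : bilinear_op dia;
  atp_dia_mul : forall x y z,
    dia x (mul y z) = mul (dia x y) z + mul y (dia x z);
  atp_br_tri : forall x y z,
    br x (tri z y) = tri z (br x y) - mul y (dia z x);
  atp_circ_dia : forall x y z,
    dia (circ mul tri y z) x = tri z (dia y x) + tri y (dia z x);
  atp_curly_tri : forall x y z,
    tri (curly br dia x z) y = dia x (tri z y) - tri z (dia x y)
}.

End AlmostPoisson.

(* Main.v *)
Require Import Defs.
From mathcomp Require Import all_boot all_order all_algebra.

Set Implicit Arguments.
Unset Strict Implicit.
Unset Printing Implicit Defensive.

Import GRing.Theory.
Local Open Scope ring_scope.

(** Everything is an axiom of the module read at elements of the form [R a].
    The axioms of a tridendriform structure have two shapes.  Those in which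
    the first argument of [dia] or [tri] is a single vector are module axioms,
    scaled by [lambda].  Those in which it is [circ a b] or [curly a b] rest on
    the Rota-Baxter identities, which say exactly that [R] carries [circ] to
    the product of [A] and [curly] to its bracket; after that they state
    that [rho] and [mu] represent products and brackets of [A]
    ([rota_baxter_tridendriform]).

    For the second claim, that [R] preserves the operations is again the
    Rota-Baxter identities, so what has to be proved is that [circ] and [curly]
    do make [V] an almost Poisson algebra.  This cannot be pulled back from [A],
    as [R] need not be injective; it holds for every almost tridendriform
    Poisson algebra ([associated_almost_poisson]).  Associativity of [circ]
    amounts, for a commutative operation, to commutation of its multiplication
    operators ([circ_left_comm]).  In the Leibniz rule for [curly x] and
    [circ y z], each of the two terms on the right is half of the left-hand
    side up to an error; the two halves, like the two errors, are exchanged by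
    swapping [y] and [z], and the errors are opposite
    ([curly_circ_leibniz]). *)

(** * Bilinear operations *)

Section Bilinear.

Variables (K : fieldType) (U : vectType K).

Section OneOperation.

Variable f : U -> U -> U.
Hypothesis hf : bilinear_op f.

Lemma bilinear_op_addl x y z : f (x + y) z = f x z + f y z.
Proof. by have := hf.1 z 1 x y; rewrite /= !scale1r. Qed.

Lemma bilinear_op_addr x y z : f x (y + z) = f x y + f x z.
Proof. by have := hf.2 x 1 y z; rewrite /= !scale1r. Qed.

Lemma bilinear_op_scalel c x y : f (c *: x) y = c *: f x y.
Proof.
have f0 : f 0 y = 0 by apply: (addrI (f 0 y)); rewrite -bilinear_op_addl !addr0.
by have := hf.1 y c x 0; rewrite /= f0 !addr0.
Qed.

Lemma bilinear_op_scaler c x y : f x (c *: y) = c *: f x y.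
Proof.
have f0 : f x 0 = 0 by apply: (addrI (f x 0)); rewrite -bilinear_op_addr !addr0.
by have := hf.2 x c y 0; rewrite /= f0 !addr0.
Qed.

Lemma bilinear_op_oppr x y : f x (- y) = - f x y.
Proof. by rewrite -scaleN1r bilinear_op_scaler scaleN1r. Qed.

Lemma bilinear_op_flip : bilinear_op (fun x y => f y x).
Proof. by split=> u c x y /=; [apply: hf.2 | apply: hf.1]. Qed.

Lemma bilinear_opZ c : bilinear_op (fun x y => c *: f x y).
Proof.
by split=> u d x y /=; rewrite (hf.1, hf.2) /= scalerDr !scalerA mulrC.
Qed.

End OneOperation.

Lemma bilinear_opD (f g : U -> U -> U) :
  bilinear_op f -> bilinear_op g -> bilinear_op (fun x y => f x y + g x y).
Proof.
move=> hf hg; split=> u c x y /=.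
  by rewrite hf.1 hg.1 /= scalerDr addrACA.
by rewrite hf.2 hg.2 /= scalerDr addrACA.
Qed.

Lemma bilinear_opB (f g : U -> U -> U) :
  bilinear_op f -> bilinear_op g -> bilinear_op (fun x y => f x y - g x y).
Proof.
move=> hf hg; have [hl hr] := bilinear_opD hf (bilinear_opZ hg (-1)).
split=> u c x y /=; first by have := hl u c x y; rewrite /= !scaleN1r.
by have := hr u c x y; rewrite /= !scaleN1r.
Qed.

(** The bracket and the product have to be scaled by the same factor: the
    Leibniz rule is homogeneous of degree one in the bracket and in the
    product, and associativity of degree two in the product. *)
Lemma almost_poisson_scale c (br mul : U -> U -> U) :
  almost_poisson br mul ->
  almost_poisson (fun x y => c *: br x y) (fun x y => c *: mul x y).
Proof.
case=> hbr hmul mulC mulA skew leib; split.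
- exact: bilinear_opZ.
- exact: bilinear_opZ.
- by move=> x y; rewrite mulC.
- move=> x y z; rewrite (bilinear_op_scalel hmul) (bilinear_op_scaler hmul).
  by rewrite mulA.
- by move=> x y; rewrite skew scalerN.
- move=> x y z; rewrite (bilinear_op_scaler hbr) (bilinear_op_scalel hmul).
  by rewrite (bilinear_op_scaler hmul) leib !scalerDr.
Qed.

End Bilinear.

(** * The almost Poisson algebra of an almost tridendriform Poisson algebra *)

Section Associated.

Variables (K : fieldType) (B : vectType K).
Variables br dia mul tri : B -> B -> B.

Section Trialgebra.

Hypothesis hT : comm_dendriform_trialgebra mul tri.

Let mulC := cdt_mulC hT.
Let mul_addr := bilinear_op_addr (cdt_mul_bilinear hT).
Let tri_addr := bilinear_op_addr (cdt_tri_bilinear hT).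

Lemma circ_bilinear : bilinear_op (circ mul tri).
Proof.
have [hm ht] := (cdt_mul_bilinear hT, cdt_tri_bilinear hT).
exact: bilinear_opD (bilinear_opD ht (bilinear_op_flip ht)) hm.
Qed.

Lemma circC x y : circ mul tri x y = circ mul tri y x.
Proof. by rewrite /circ mulC [tri x y + _]addrC. Qed.

Lemma tri_left_comm x y z : tri x (tri y z) = tri y (tri x z).
Proof. by rewrite -!(cdt_circ_tri hT) circC. Qed.

(** Both sides expand to the same seven terms.  Only the term
    [tri x (tri y z)] is not visibly symmetric in [x] and [y]. *)
Lemma circ_left_comm x y z :
  circ mul tri x (circ mul tri y z) = circ mul tri y (circ mul tri x z).
Proof.
have mul_tri u v w : mul u (tri v w) = tri v (mul u w).
  by rewrite mulC (cdt_tri_mul hT) mulC.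
have expand u v : circ mul tri u (circ mul tri v z) =
    tri u (tri v z) + (tri u (tri z v) + tri v (tri z u)) +
    (tri u (mul v z) + tri v (mul u z)) + (tri z (mul u v) + mul u (mul v z)).
  rewrite {1}/circ (cdt_circ_tri hT) /circ !(tri_addr, mul_addr) !mul_tri.
  by rewrite !addrA [LHS](ACl (1*2*4*3*5*6*7)).
rewrite !expand (tri_left_comm x y z).
rewrite [tri x (tri z y) + _]addrC [tri x (mul y z) + _]addrC.
by rewrite -!(cdt_mulA hT) (mulC x y).
Qed.

Lemma circA x y z :
  circ mul tri (circ mul tri x y) z = circ mul tri x (circ mul tri y z).
Proof. by rewrite circC circ_left_comm [circ _ _ z y]circC. Qed.

End Trialgebra.

Hypothesis hB : almost_tridendriform_poisson br dia mul tri.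

Let hT := atp_trialgebra hB.
Let mulC := cdt_mulC hT.
Let mul_add := bilinear_op_addr (cdt_mul_bilinear hT).
Let tri_add := bilinear_op_addr (cdt_tri_bilinear hT).
Let mul_opp := bilinear_op_oppr (cdt_mul_bilinear hT).
Let tri_opp := bilinear_op_oppr (cdt_tri_bilinear hT).
Let br_add := bilinear_op_addr (ap_br_bilinear (atp_poisson hB)).
Let dia_add := bilinear_op_addr (atp_dia_bilinear hB).

(** When everything is expanded, no value of [dia x] stands under [tri] on the
    left.  On the right, [tri y (dia x z)] comes from [tri y (curly x z)], and
    with the opposite sign from [tri (curly x y) z]; likewise with [y] and [z]
    exchanged.  These are the errors that cancel. *)
Lemma curly_circ_leibniz x y z :
  curly br dia x (circ mul tri y z) =
    circ mul tri (curly br dia x y) z + circ mul tri y (curly br dia x z).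
Proof.
(* [main y z] and [main z y] are the two halves of the left-hand side. *)
pose main u v := dia x (tri u v) + mul v (dia x u) - tri v (dia u x)
  + (tri v (br x u) - mul v (dia u x)) + mul v (br x u).
have half u v : circ mul tri v (curly br dia x u) =
    main u v + (tri v (dia x u) - tri u (dia x v)).
  rewrite /circ (atp_curly_tri hB) /curly !(tri_add, mul_add, tri_opp, mul_opp).
  by rewrite /main !addrA [LHS](ACl (4*6*2*3*7*8*1*5)).
have total : curly br dia x (circ mul tri y z) = main y z + main z y.
  rewrite /curly (atp_circ_dia hB) /circ !(dia_add, br_add) !(atp_br_tri hB).
  rewrite (atp_dia_mul hB) (ap_leibniz (atp_poisson hB)) /main.
  rewrite (mulC (dia x y)) (mulC (br x y)) opprD !addrA.
  by rewrite [LHS](ACl (1*3*5*9*8*11*2*4*6*7*10*12)).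
rewrite total (circC hT) !half [RHS]addrACA.
by rewrite -(opprB (tri z (dia x y))) addrN addr0.
Qed.

Lemma associated_almost_poisson :
  almost_poisson (curly br dia) (circ mul tri).
Proof.
have [hP hdia] := (atp_poisson hB, atp_dia_bilinear hB).
split.
- have hcomm := bilinear_opB hdia (bilinear_op_flip hdia).
  exact: bilinear_opD hcomm (ap_br_bilinear hP).
- exact: circ_bilinear.
- exact: circC.
- exact: circA.
- by move=> x y; rewrite /curly (ap_br_skew hP x y) opprD opprB.
- exact: curly_circ_leibniz.
Qed.

End Associated.

(** * The structure induced by a Rota-Baxter operator *)

Section RotaBaxter.

Variables (K : fieldType) (A V : vectType K).
Variables (brA mulA : A -> A -> A) (brV mulV : V -> V -> V).
Variables (rho mu : {linear A -> 'End(V)}) (lambda : K) (R : {linear V -> A}).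
Hypothesis hV : module_almost_poisson brA mulA brV mulV rho mu.
Hypothesis hR : rota_baxter brA mulA brV mulV rho mu lambda R.

Let br (a b : V) := lambda *: brV a b.
Let dia (a b : V) := rho (R a) b.
Let mul (a b : V) := lambda *: mulV a b.
Let tri (a b : V) := mu (R a) b.

Lemma rota_baxter_circ a b : R (circ mul tri a b) = mulA (R a) (R b).
Proof. by rewrite (rb_mul hR). Qed.

Lemma rota_baxter_curly a b : R (curly br dia a b) = brA (R a) (R b).
Proof. by rewrite (rb_br hR). Qed.

Lemma action_bilinear (phi : {linear A -> 'End(V)}) :
  bilinear_op (fun a b => phi (R a) b).
Proof.
split=> u c x y /=; last by rewrite linearP.
by rewrite !linearP /= add_lfunE scale_lfunE.
Qed.

Lemma rota_baxter_trialgebra : comm_dendriform_trialgebra mul tri.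
Proof.
have hP := almost_poisson_scale lambda (mod_mod hV).
split.
- exact: ap_mul_bilinear hP.
- exact: action_bilinear.
- exact: ap_mulC hP.
- exact: ap_mulA hP.
- by move=> x y z; rewrite /tri rota_baxter_circ (mod_muM hV) comp_lfunE.
- by move=> x y z; rewrite /mul /tri -(mod_mu_mul hV) linearZ.
Qed.

Lemma rota_baxter_tridendriform : almost_tridendriform_poisson br dia mul tri.
Proof.
split.
- exact: almost_poisson_scale (mod_mod hV).
- exact: rota_baxter_trialgebra.
- exact: action_bilinear.
- by move=> x y z; rewrite /dia /mul linearZ /= (mod_rho_mul hV) scalerDr.
- move=> x y z; rewrite /br /tri /mul /dia (mod_br_mu hV) linearZ scalerDr.
  by rewrite scalerN addrC (ap_mulC (mod_mod hV)).
- move=> x y z; rewrite /dia rota_baxter_circ (mod_rhoM hV).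
  by rewrite add_lfunE !comp_lfunE.
- move=> x y z; rewrite /tri rota_baxter_curly (mod_mu_br hV).
  by rewrite add_lfunE opp_lfunE !comp_lfunE.
Qed.

End RotaBaxter.

Theorem theorem4p16 (K : fieldType) (charK0 : [pchar K] =i pred0)
    (A V : vectType K) (brA mulA : A -> A -> A) (brV mulV : V -> V -> V)
    (rho mu : {linear A -> 'End(V)}) (lambda : K) (R : {linear V -> A})
    (hA : almost_poisson brA mulA)
    (hV : module_almost_poisson brA mulA brV mulV rho mu)
    (hR : rota_baxter brA mulA brV mulV rho mu lambda R) :
  let br := fun a b : V => lambda *: brV a b in
  let dia := fun a b : V => rho (R a) b in
  let mul := fun a b : V => lambda *: mulV a b in
  let tri := fun a b : V => mu (R a) b in
  almost_tridendriform_poisson br dia mul tri /\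
  almost_poisson_hom (curly br dia) (circ mul tri) brA mulA R.
Proof.
move=> br dia mul tri.
have hB : almost_tridendriform_poisson br dia mul tri.
  exact: rota_baxter_tridendriform hV hR.
split=> //; split=> //; first exact: associated_almost_poisson hB.
  exact: rota_baxter_circ hR.
exact: rota_baxter_curly hR.
Qed.
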